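(* Let $r = p/q$, where $p, q$ are positive integers with $p > q^2$. Then for every $\epsilon > 0$ there exists a set $A(\epsilon) \subset [0,1)$ with finite boundary and with Lebesgue measure less than $\epsilon$ such that the set of positive real numbers $\lambda$ satisfying $$\langle \lambda r^n \rangle \in A(\epsilon) \quad \text{for all } n \in \mathbb{N}$$ is uncountable.
   Context: For a real number $x$, $\langle x \rangle = x - \lfloor x \rfloor$ denotes the fractional part of $x$. $\mathbb{N}$ denotes the set of non-negative integers. *)

(* Defs.v *)
From HB Require Import structures.
From mathcomp Require Import all_boot all_order all_algebra.
From mathcomp Require Import all_classical all_reals all_analysis.

Set Implicit Arguments.
Unset Strict Implicit.
Unset Printing Implicit Defensive.

Import Order.TTheory GRing.Theory Num.Theory.
Import numFieldNormedType.Exports.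

Local Open Scope classical_set_scope.
Local Open Scope ring_scope.

Definition fracpart (R : realType) (x : R) : R := x - (Num.floor x)%:~R.

Definition boundary (T : topologicalType) (A : set T) : set T :=
  closure A `\` interior A.

(* Main.v *)
(* Write [lambda * r ^+ n = g n + f n] with [g n] integral and [f n] in [0, 1).
   Then [s n = q * g n.+1 - p * g n] is an integer and
   [f n = (s n + q * f n.+1) / p]; conversely, choosing [g n.+1] from [g n]
   freely among the integers with small nonnegative [s n] determines [lambda].
   Take the least choice, [0 <= s n < q], except that at each multiple of a large
   [N] we may add one to [g n.+1]: these binary choices produce uncountably many
   [lambda]. A window of [N] digits meets one multiple of [N], hence takes at
   most [2 * q ^ N] values, and determines [f n] up to [(q / p) ^ N]. There are
   [N] positions of the window modulo [N], so all [f n] lie in a finite union of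
   intervals of total length [2 * N * (q ^ 2 / p) ^ N], which tends to 0. *)
Require Import Defs.
From HB Require Import structures.
From mathcomp Require Import all_boot all_order all_algebra.
From mathcomp Require Import all_classical all_reals all_analysis.
From mathcomp Require Import zify ring lra.

Set Implicit Arguments.
Unset Strict Implicit.
Unset Printing Implicit Defensive.

Import Order.TTheory GRing.Theory Num.Theory.
Import numFieldNormedType.Exports.

Local Open Scope classical_set_scope.
Local Open Scope ring_scope.

(** * Finite boundaries and measure of finite unions of intervals *)

Lemma boundaryU (T : topologicalType) (A B : set T) :
  boundary (A `|` B) `<=` boundary A `|` boundary B.
Proof.
move=> x []; rewrite closureU => cl int.
have intA : ~ interior A x by move=> h; apply/int/interiorU; left.
have intB : ~ interior B x by move=> h; apply/int/interiorU; right.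
by case: cl => cl; [left|right].
Qed.

Lemma boundaryI (T : topologicalType) (A B : set T) :
  boundary (A `&` B) `<=` boundary A `|` boundary B.
Proof.
move=> x [] /closureI[clA clB]; rewrite interiorI => int.
have [intA|?] := pselect (interior A x); last by left.
by right; split=> // intB; apply: int.
Qed.

Lemma finite_boundary_itv (R : realType) (a b : bool) (x y : R) :
  finite_set (boundary [set` Interval (BSide a x) (BSide b y)]).
Proof.
apply: (@sub_finite_set _ _ [set x; y]); last exact: finite_set2.
move=> z []; rewrite interior_itv_bnd => cl int.
have : `[x, y]%classic z.
  have /closure_id -> := @itv_closed _ R x y.
  apply: closure_subset cl => t /=; apply: subitvP.
  by rewrite subitvE !bnd_simp; case: (a) (b) => [] [].
rewrite /= in_itv /= => /andP[xz zy].
move: int; rewrite /= in_itv /= => /negP; rewrite negb_and -!leNgt.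
by case/orP=> h; [left|right]; apply/eqP; rewrite eq_le ?xz ?zy h.
Qed.

Definition cover_by (R : realType) (d : R) (s : seq R) : set R :=
  [set x | exists2 e, e \in s & e <= x <= e + d].

Lemma cover_by_nil (R : realType) (d : R) : cover_by d [::] = set0.
Proof. by apply/seteqP; split=> x // []. Qed.

Lemma cover_by_cons (R : realType) (d e : R) (s : seq R) :
  cover_by d (e :: s) = `[e, e + d]%classic `|` cover_by d s.
Proof.
apply/seteqP; split=> x /=.
  by move=> [f]; rewrite inE => /orP[/eqP->|fs] h; [left; rewrite in_itv|right; exists f].
move=> []; first by rewrite in_itv => h; exists e; rewrite ?mem_head.
by move=> [f fs h]; exists f; rewrite // inE fs orbT.
Qed.

Lemma finite_boundary_cover_by (R : realType) (d : R) (s : seq R) :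
  finite_set (boundary (cover_by d s)).
Proof.
elim: s => [|e s IHs].
  by rewrite cover_by_nil /boundary closure0 set0D; exact: finite_set0.
rewrite cover_by_cons; apply: sub_finite_set (@boundaryU _ _ _) _.
by rewrite finite_setU; split=> //; exact: finite_boundary_itv.
Qed.

Lemma measurable_cover_by (R : realType) (d : R) (s : seq R) :
  measurable (cover_by d s).
Proof.
elim: s => [|e s IHs]; first by rewrite cover_by_nil; exact: measurable0.
by rewrite cover_by_cons; apply: measurableU => //; exact: measurable_itv.
Qed.

Lemma measure_cover_by (R : realType) (d : R) (s : seq R) : 0 <= d ->
  (lebesgue_measure (cover_by d s) <= ((size s)%:R * d)%:E)%E.
Proof.
move=> d0; elim: s => [|e s IHs]; first by rewrite cover_by_nil measure0 mul0r.
have itv_le : (lebesgue_measure `[e, (e + d)%R]%classic <= d%:E)%E.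
  rewrite lebesgue_measure_itv /= lte_fin.
  by case: ifP => _; rewrite ?lee_fin //; lra.
rewrite cover_by_cons /= -natr1 mulrDl mul1r EFinD addeC.
apply: le_trans (leeD itv_le IHs); apply: measureU2; first exact: measurable_itv.
exact: measurable_cover_by.
Qed.

(** * Multipliers with prescribed integer parts, and their digit expansions *)

Lemma nested_intervals (R : realType) (u v : nat -> R) :
  (forall n, u n <= u n.+1) -> (forall n, v n.+1 <= v n) ->
  (forall n, u n <= v n) -> exists x, forall n, u n <= x <= v n.
Proof.
move=> /nondecreasing_seqP uP /nonincreasing_seqP vP uv.
have ub m : ubound (range u) (v m).
  move=> _ [n _ <-]; apply: le_trans (uP _ _ (leq_maxl n m)) _.
  exact: le_trans (uv _) (vP _ _ (leq_maxr n m)).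
exists (sup (range u)) => n; apply/andP; split.
  by apply: ub_le_sup; [exists (v 0%N)|exists n].
by apply: ge_sup => //; exists (u 0%N), 0%N.
Qed.

(* The integer parts of [lambda * (p / q) ^+ n]: the least admissible value
   [ceil (p / q * g)], increased by one whenever [b n] holds. *)
Fixpoint intpart (p q : nat) (b : nat -> bool) (n : nat) : nat :=
  if n is m.+1 then ((p * intpart p q b m + q.-1) %/ q + b m)%N else 1%N.

(** Bounds the digit [s n] by [0 <= s n < q * (b n).+1]: adding [q.-1] before dividing by [q] rounds
    up. *)
Lemma intpart_step (p q : nat) (b : nat -> bool) n : (0 < q)%N ->
  (p * intpart p q b n <= q * intpart p q b n.+1
     < p * intpart p q b n + q * (b n).+1)%N.
Proof.
move=> q0 /=; set m := (p * _)%N.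
have := divn_eq (m + q.-1) q; have := ltn_pmod (m + q.-1) q0; nia.
Qed.

(* An upper bound for [f n]: an exact solution would satisfy
   [p * c n = (largest s n) + q * c n.+1]; when [~~ (N %| n)] we use the cruder
   [c n.+1 <= 1], so that [c n < 1] reduces to an inequality following from
   [q ^ 2 < p]. *)
Definition excess (R : realType) (p q N n : nat) : R :=
  let k := (2 * q%:R - 1) / p%:R in
  if (N %| n)%N then (2 * q%:R - 1 + q%:R * k) / p%:R else k.

Lemma excess_bounds (R : realType) (p q N n : nat) : (0 < q)%N ->
  (q ^ 2 < p)%N -> 0 <= excess R p q N n < 1.
Proof.
move=> q0 qp.
have Q1 : 1 <= q%:R :> R by rewrite ler1n.
have P0 : (q%:R : R) ^+ 2 + 1 <= p%:R by rewrite -natrX natr1 ler_nat.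
set Q := q%:R in Q1 P0 *; set P : R := p%:R in P0 *.
have P2 : 0 < P by nra.
have k0 : 0 <= (2 * Q - 1) / P by rewrite divr_ge0; lra.
(* This is [excess < 1] at a multiple of [N], multiplied by [P ^+ 2]. For [Q >= 3] the bound
   [P >= Q ^+ 2 + 1] leaves ample room; [Q = 1] and [Q = 2] are checked separately. *)
have key : (2 * Q - 1) * P + Q * (2 * Q - 1) < P ^+ 2.
  suff : 0 < P * (P - (2 * Q - 1)) - Q * (2 * Q - 1) by nra.
  have [Q3|] := leP 3 Q.
    have : 5 <= P - (2 * Q - 1) by nra.
    nra.
  rewrite /Q (ltr_nat R q 3) => q3.
  have : q%:R = 1 :> R \/ q%:R = 2 :> R.
    by case: (q) q0 q3 => [|[|[|]]] // _ _; [left|right].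
  rewrite /Q in P0 *; case=> e; rewrite e in P0 *; nra.
have kP : (2 * Q - 1) / P * P = 2 * Q - 1 by rewrite divfK // gt_eqF.
have k1 : (2 * Q - 1) / P < 1 by rewrite ltr_pdivrMr //; nra.
rewrite /excess -/Q -/P; case: ifP => _; last by rewrite k0 k1.
apply/andP; split; first by rewrite divr_ge0 //; nra.
rewrite ltr_pdivrMr // mul1r.
rewrite -(ltr_pM2r P2) mulrDl -mulrA kP -expr2; lra.
Qed.

(** Makes the upper ends [(g n + excess n) / r ^+ n] nonincreasing. Since [1 < N], a multiple of [N]
    is never followed by another, so equality holds there. *)
Lemma excess_step (R : realType) (p q N n : nat) : (1 < N)%N -> (0 < q)%N ->
  (q ^ 2 < p)%N ->
  (q * (N %| n)%N.+1)%:R - 1 + q%:R * excess R p q N n.+1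
    <= p%:R * excess R p q N n.
Proof.
move=> N1 q0 qp.
have /andP[_ e1] := excess_bounds R N n.+1 q0 qp.
have P0 : p%:R != 0 :> R by rewrite pnatr_eq0 -lt0n; lia.
have Q1 : 0 <= q%:R :> R by [].
rewrite {2}/excess; case: (boolP (N %| n)%N) => Nn /=.
  rewrite [leRHS]mulrC divfK // /excess ifN; last by rewrite -addn1 dvdn_addr // dvdn1; lia.
  by rewrite natrM; lra.
by rewrite [leRHS]mulrC divfK // muln1; have := ler_wpM2l Q1 (ltW e1); lra.
Qed.

(** The intervals from [g n / r ^+ n] to [(g n + excess n) / r ^+ n] are nested; [x] is a common
    point. *)
Lemma exists_multiplier (R : realType) (p q N : nat) (b : nat -> bool) :
  (1 < N)%N -> (0 < q)%N -> (q ^ 2 < p)%N -> (forall n, b n -> (N %| n)%N) ->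
  exists x : R, forall n,
    (intpart p q b n)%:R <= x * (p%:R / q%:R) ^+ n
      <= (intpart p q b n)%:R + excess R p q N n.
Proof.
move=> N1 q0 qp bN; set r := p%:R / q%:R; set g := intpart p q b.
have Q0 : 0 < q%:R :> R by rewrite ltr0n.
have r0 : 0 < r by rewrite divr_gt0 // ltr0n; lia.
have rX n : 0 < r ^+ n by rewrite exprn_gt0.
have step n (y z : R) : q%:R * y <= p%:R * z -> y / r ^+ n.+1 <= z / r ^+ n.
  move=> h; rewrite ler_pdivrMr // exprSr mulrA divfK ?gt_eqF //.
  by rewrite /r mulrA ler_pdivlMr // mulrC (mulrC z).
have step' n (y z : R) : p%:R * z <= q%:R * y -> z / r ^+ n <= y / r ^+ n.+1.
  move=> h; rewrite ler_pdivlMr // exprSr mulrA divfK ?gt_eqF //.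
  by rewrite /r mulrA ler_pdivrMr // mulrC (mulrC y).
have [||n|x xP] := @nested_intervals R (fun n => (g n)%:R / r ^+ n)
    (fun n => ((g n)%:R + excess R p q N n) / r ^+ n).
- move=> n; apply: step'; rewrite -!natrM ler_nat.
  by have /andP[] := intpart_step p b n q0.
- move=> n; apply: step; rewrite !mulrDr.
  have /andP[_ ub] := intpart_step p b n q0.
  have e := excess_step R n N1 q0 qp.
  have h : (q * g n.+1)%:R + 1 <= (p * g n)%:R + (q * (N %| n)%N.+1)%:R :> R.
    rewrite natr1 -natrD ler_nat; apply: leq_trans ub _.
    rewrite leq_add2l leq_pmul2l // ltnS; case: (b n) (bN n) => // -> //.
  rewrite !natrM in h e *; lra.
- rewrite ler_pM2r ?invr_gt0 // lerDl.
  by have /andP[] := excess_bounds R N n q0 qp.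
exists x => n; have /andP[] := xP n.
by rewrite ler_pdivrMr // ler_pdivlMr // => -> ->.
Qed.

(* Values of the [m] leading terms of the expansion
   [f n = \sum_k s (n + k) * (q / p) ^+ k / p] of the fractional parts, where
   the digit [s i] ranges over [0 .. q - 1], or [0 .. 2 q - 1] if [N %| i]. *)
Fixpoint windows (R : realType) (p q N n m : nat) : seq R :=
  if m is m'.+1 then
    [seq (s%:R + q%:R * e) / p%:R | s <- iota 0 (q * (N %| n)%N.+1),
                                    e <- windows R p q N n.+1 m']
  else [:: 0].

(** Reduces the windows at all positions to [N] finite lists. *)
Lemma windows_mod (R : realType) (p q N n m : nat) :
  windows R p q N (n %% N) m = windows R p q N n m.
Proof.
have H k n' : n = n' %[mod N] -> windows R p q N n k = windows R p q N n' k.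
  elim: k n n' => [//|k IHk] n1 n2 e /=.
  rewrite (IHk n1.+1 n2.+1); last by rewrite -(addn1 n1) -(addn1 n2) -(modnDml n1) e modnDml.
  by rewrite /dvdn e.
by apply/esym/H; rewrite modn_mod.
Qed.

(** Among [m <= N] consecutive positions at most one is a multiple of [N], so the doubled choice
    occurs at most once. *)
Lemma size_windows_le (R : realType) (p q N n m : nat) : (m <= N)%N ->
  (size (windows R p q N n m) <= 2 * q ^ m)%N.
Proof.
have nomult k n' : (forall i, (i < k)%N -> ~~ (N %| n' + i)%N) ->
    size (windows R p q N n' k) = (q ^ k)%N.
  elim: k n' => [//|k IHk] n' h /=.
  rewrite size_allpairs size_iota IHk; last by move=> i ik; rewrite addSnnS h.
  by have := h 0%N isT; rewrite addn0 => /negPf ->; rewrite muln1 expnS.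
elim: m n => [//|m IHm] n mN /=.
rewrite size_allpairs size_iota expnS.
case: (boolP (N %| n)%N) => Nn; last first.
  by rewrite muln1 mulnCA leq_mul2l IHm ?orbT // ltnW.
rewrite nomult; first by rewrite (mulnC q) mulnA.
move=> i im; rewrite addSnnS dvdn_addr // gtnNdvd //.
exact: leq_trans mN.
Qed.

(** Unroll the recurrence [m] times and replace the tail [f (n + m)], which lies in [0, 1), by 0. *)
Lemma windows_approx (R : realType) (p q N : nat) (s : nat -> nat)
    (f : nat -> R) : (0 < p)%N ->
  (forall n, s n < q * (N %| n)%N.+1)%N -> (forall n, 0 <= f n < 1) ->
  (forall n, f n = ((s n)%:R + q%:R * f n.+1) / p%:R) ->
  forall n m, exists2 e, e \in windows R p q N n m &
    e <= f n <= e + (q%:R / p%:R) ^+ m.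
Proof.
move=> p0 sb f01 fE n m; elim: m n => [|m IHm] n.
  exists 0; first by rewrite mem_seq1.
  by rewrite add0r expr0; have /andP[-> /ltW ->] := f01 n.
have [e eW /andP[le ge]] := IHm n.+1.
exists (((s n)%:R + q%:R * e) / p%:R).
  by apply/allpairsP; exists (s n, e); rewrite mem_iota sb.
have P0 : 0 < p%:R :> R by rewrite ltr0n.
have Q0 : 0 <= q%:R :> R by [].
have -> : (q%:R / p%:R : R) ^+ m.+1 = q%:R * (q%:R / p%:R) ^+ m / p%:R.
  by rewrite exprS; ring.
by rewrite fE -mulrDl !ler_pM2r ?invr_gt0 // -addrA -mulrDr !lerD2l !ler_wpM2l.
Qed.

Lemma bernoulli_ineq (R : realType) (h : R) n : 0 <= h ->
  1 + n%:R * h <= (1 + h) ^+ n.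
Proof.
move=> h0; elim: n => [|n IHn]; first by rewrite mul0r addr0 expr0.
rewrite exprS -natr1; have : 0 <= n%:R :> R by [].
nra.
Qed.

Lemma natr_mul_expr_small (R : realType) (x eps : R) : 0 < x < 1 -> 0 < eps ->
  exists2 N : nat, (1 < N)%N & N%:R * x ^+ N < eps.
Proof.
move=> /andP[x0 x1] eps0; pose h := x^-1 - 1.
have h0 : 0 < h by rewrite subr_gt0 invf_gt1.
have c0 : 0 < eps * h ^+ 2 by rewrite mulr_gt0 // exprn_gt0.
pose M := (Num.truncn (2 / (eps * h ^+ 2))).+1.
have M1 : (0 < M)%N by [].
have MP : 2 / (eps * h ^+ 2) < M%:R.
  by rewrite /M -truncn_lt_nat // divr_ge0 // ltW.
rewrite ltr_pdivrMr // in MP.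
have Mr : 1 <= M%:R :> R by rewrite ler1n.
(* Squaring Bernoulli's bound gives [x ^+ (M * 2) <= (M * h) ^- 2], and this quadratic decay beats
   the factor [M * 2]. *)
exists (M * 2)%N; first by lia.
have B : M%:R * h <= x^-1 ^+ M.
  have := @bernoulli_ineq R h M (ltW h0).
  by rewrite [1 + h]addrC subrK; lra.
have Mh : 0 < M%:R * h by nra.
have xM : x ^+ (M * 2) = (x^-1 ^+ M) ^- 2 by rewrite !exprVn invrK exprM.
rewrite xM natrM.
have Y0 : 0 < (x^-1 ^+ M) ^+ 2 by rewrite exprn_gt0 // (lt_le_trans Mh).
rewrite ltr_pdivrMr //.
apply: (@lt_le_trans _ _ (eps * (M%:R * h) ^+ 2)).
  have -> : eps * (M%:R * h) ^+ 2 = M%:R * (M%:R * (eps * h ^+ 2)) by ring.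
  by rewrite ltr_pM2l //; lra.
by rewrite ler_pM2l // ler_sqr // ?nnegrE; [lra|apply: le_trans B; lra].
Qed.

(** Cantor's diagonal argument: [c] is built to differ from each [c'] at the index [f (F c')]. *)
Lemma uncountable_inj_image (T : Type) (S : set T) (F : (nat -> bool) -> T) :
  (forall c, S (F c)) -> (forall c c', F c = F c' -> c =1 c') -> ~ countable S.
Proof.
move=> FS Finj /countable_injP[f finj].
pose c n := ~~ `[< exists2 c', f (F c') = n & c' n >].
have : c (f (F c)) = ~~ c (f (F c)).
  rewrite {1}/c; congr (~~ _); apply/asboolP/idP => [[c' e c'n]|cn]; last by exists c.
  by rewrite -(Finj c' c) //; apply: finj e; rewrite inE.
by case: (c _).
Qed.

Theorem theorem1 (R : realType) (p q : nat) (r : R)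
  (hp : (0 < p)%N) (hq : (0 < q)%N) (hpq : (q ^ 2 < p)%N)
  (hr : r = p%:R / q%:R) :
  forall eps : R, 0 < eps ->
  exists A : set R,
    [/\ A `<=` `[0, 1[,
        finite_set (boundary A),
        measurable A,
        (lebesgue_measure A < eps%:E)%E
      & ~ countable [set lambda : R | 0 < lambda /\
            forall n : nat, A (fracpart (lambda * r ^+ n))]].
Proof.
move=> eps eps0.
have P0 : 0 < p%:R :> R by rewrite ltr0n.
have Q0 : 0 < q%:R :> R by rewrite ltr0n.
have rho01 : 0 < (q%:R ^+ 2 / p%:R : R) < 1.
  by rewrite divr_gt0 ?exprn_gt0 //= ltr_pdivrMr // mul1r -natrX ltr_nat.
(* Halving [eps] absorbs the factor 2 in the window count [2 * q ^ N]. *)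
have [|N N1 Neps] := natr_mul_expr_small rho01 (_ : 0 < eps / 2); first by lra.
pose s := flatten [seq windows R p q N n N | n <- iota 0 N].
pose d : R := (q%:R / p%:R) ^+ N.
have d0 : 0 <= d by rewrite exprn_ge0 // divr_ge0.
have size_s : (size s <= N * (2 * q ^ N))%N.
  rewrite size_flatten /shape -map_comp sumnE big_map.
  apply: leq_trans (_ : \sum_(i <- iota 0 N) (2 * q ^ N) <= _)%N.
    by apply: leq_sum => i _ /=; exact: size_windows_le.
  by rewrite big_const_seq count_predT size_iota iter_addn_0 mulnC.
exists (`[0, 1[%classic `&` cover_by d s); split.
- by move=> x [].
- apply: sub_finite_set (@boundaryI _ _ _) _; rewrite finite_setU.
  by split; [exact: finite_boundary_itv|exact: finite_boundary_cover_by].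
- by apply: measurableI; [exact: measurable_itv|exact: measurable_cover_by].
- apply: (@le_lt_trans _ _ (lebesgue_measure (cover_by d s))).
    apply: le_measure; rewrite ?inE; [|exact: measurable_cover_by|exact: subIsetr].
    by apply: measurableI; [exact: measurable_itv|exact: measurable_cover_by].
  apply: le_lt_trans (measure_cover_by s d0) _; rewrite lte_fin.
  apply: (@le_lt_trans _ _ ((N * (2 * q ^ N))%:R * d)).
    by rewrite ler_wpM2r // ler_nat.
  have -> : (N * (2 * q ^ N))%:R * d = 2 * (N%:R * (q%:R ^+ 2 / p%:R) ^+ N).
    have -> : (q%:R ^+ 2 / p%:R) ^+ N = q%:R ^+ N * d.
      by rewrite /d -exprMn mulrA expr2.
    by rewrite !natrM natrX; ring.
  lra.
pose b (c : nat -> bool) n := (N %| n)%N && c (n %/ N)%N.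
have bN c n : b c n -> (N %| n)%N by case/andP.
have [F FP] := choice (fun c => exists_multiplier R N1 hq hpq (bN c)).
rewrite -hr in FP.
have f01 c n : 0 <= F c * r ^+ n - (intpart p q (b c) n)%:R < 1.
  have /andP[lo hi] := FP c n; have /andP[_ e1] := excess_bounds R N n hq hpq.
  by apply/andP; split; lra.
(* The integer parts are recovered from [F c] alone, which will give injectivity. *)
have FE c n : Num.truncn (F c * r ^+ n) = intpart p q (b c) n.
  by apply: truncn_def; have /andP[lo hi] := f01 c n; rewrite -natr1; lra.
apply: (@uncountable_inj_image _ _ F) => [c|c c' e m].
  (* Positivity comes from the initial integer part 1. *)
  split; first by have /andP[] := FP c 0%N; rewrite expr0 mulr1 /=; lra.
  move=> n; set x := F c * r ^+ n; set g := intpart p q (b c).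
  have -> : fracpart x = x - (g n)%:R.
    rewrite /fracpart (@floor_def _ _ (g n)%:Z) //.
    rewrite intrD -!pmulrn; have := f01 c n; rewrite -/g -/x => /andP[lo hi].
    by apply/andP; split; lra.
  split; first by rewrite /= in_itv /=; exact: f01.
  (* The digit is a truncated subtraction in [nat]; [intpart_step] ensures that nothing is cut
     off. *)
  have [|||e eW eP] := @windows_approx R p q N
      (fun n => q * g n.+1 - p * g n)%N (fun n => F c * r ^+ n - (g n)%:R) hp
      _ _ _ n N.
  + move=> k; have /andP[lo hi] := intpart_step p (b c) k hq.
    rewrite ltn_subLR //; apply: leq_trans hi _.
    by rewrite leq_add2l leq_pmul2l // ltnS; case: (b c k) (bN c k) => // ->.
  + exact: f01.
  + move=> k; have /andP[lo hi] := intpart_step p (b c) k hq.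
    rewrite natrB // !natrM exprS hr.
    by field; rewrite ?gt_eqF.
  exists e => //; apply/flattenP; exists (windows R p q N n N) => //.
  apply/mapP; exists (n %% N)%N; first by rewrite mem_iota ltn_mod; lia.
  by rewrite windows_mod.
(* Equal integer parts at [m * N] force equal rounded-up values at the next index, so only the added
   bits remain to compare. *)
have bE : b c (m * N)%N = b c' (m * N)%N.
  have g1 := FE c (m * N).+1; have g2 := FE c' (m * N).+1.
  have g3 := FE c (m * N)%N; have g4 := FE c' (m * N)%N.
  rewrite e {}g2 /= -{}g3 -{}g4 e in g1; move/addnI: g1.
  by case: (b c _); case: (b c' _).
by move: bE; rewrite /b dvdn_mull // mulnK //; lia.
Qed.
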